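(* Let $\mathbb{N}=\{1,2,3,\dots\}$, let $T:\mathbb{N}\to\mathbb{N}$ be the Collatz map $T(n)=n/2$ if $n$ is even and $T(n)=(3n+1)/2$ if $n$ is odd, and let $\mu$ be the counting measure on $(\mathbb{N},2^{\mathbb{N}})$. The following are equivalent. (1) There exists a finite measure $\alpha$ on $(\mathbb{N},2^{\mathbb{N}})$ equivalent to $\mu$ for which the dynamical system $(\mathbb{N},2^{\mathbb{N}},T,\alpha)$ is power bounded in $L^1(\alpha)$ and has conservative part $\{1,2\}$. (2) For each $n\in\mathbb{N}$ there exists $k$ such that $T^k(n)\in\{1,2\}$.
   Context: $2^{\mathbb{N}}$ is the power set of $\mathbb{N}$. A measure $\nu$ on $(\mathbb{N},2^{\mathbb{N}})$ is determined by its values $\nu(n)=\nu(\{n\})$, and it is assumed that $\nu(n)<\infty$ for each $n$; it is finite if $\sum_n\nu(n)<\infty$. The counting measure is $\mu(n)=1$ for all $n$. A measure $\alpha$ is equivalent to $\mu$ if $\alpha(n)>0$ for every $n\in\mathbb{N}$. $T$ is non-singular with respect to $\nu$ if $\nu(A)=0$ implies $\nu(T^{-1}(A))=0$; this is automatic for measures equivalent to $\mu$. The system $(\mathbb{N},2^{\mathbb{N}},T,\alpha)$ is power bounded in $L^1(\alpha)$ if there is a finite constant $M$ such that $\alpha(T^{-n}(A))\le M\alpha(A)$ for all $A\subset\mathbb{N}$ and all $n\in\mathbb{N}$. Conservative part: by the Hopf decomposition, for a measure $\nu$ for which $T$ is non-singular, $\mathbb{N}$ decomposes into disjoint sets $C$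 (the conservative part) and $D=C^c$ (the dissipative part) such that $C\subset T^{-1}(C)$; the restriction of $T$ to $C$ is conservative, i.e. for every subset of $C$ of positive measure, almost every point of it returns to it infinitely often under $T$ (in particular, if $\nu(m)>0$ for every $m\in C$, then for each $m\in C$ there is $k(m)\in\mathbb{N}$ with $T^{k(m)}(m)=m$); and $D$ is an at most countable union of wandering sets, where $W$ is wandering if $T^{-i}(W)\cap T^{-j}(W)=\emptyset$ for all $i\ne j$ in $\mathbb{N}$. The decomposition is the same for all measures equivalent to $\nu$. *)

(* Defs.v *)
From HB Require Import structures.
From mathcomp Require Import all_boot all_order all_algebra.
From mathcomp Require Import all_classical all_reals all_analysis.

Set Implicit Arguments.
Unset Strict Implicit.
Unset Printing Implicit Defensive.

Import Order.TTheory GRing.Theory Num.Theory.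

Local Open Scope classical_set_scope.
Local Open Scope nat_scope.

(* The natural numbers start at 1. *)
Record posN : Type := PosN { posN_val :> nat; posN_gt0 : 0 < posN_val }.

HB.instance Definition _ := [isSub for posN_val].
HB.instance Definition _ := [Countable of posN by <:].

Definition posN1 : posN := @PosN 1 isT.
Definition posN2 : posN := @PosN 2 isT.

HB.instance Definition _ := isPointed.Build posN posN1.

HB.instance Definition _ := @isMeasurable.Build default_measure_display
  posN discrete_measurable discrete_measurable0
  discrete_measurableC discrete_measurableU.

Definition collatz_nat (n : nat) : nat :=
  if odd n then (3 * n + 1) %/ 2 else n %/ 2.

Lemma collatz_nat_gt0 (n : nat) : 0 < n -> 0 < collatz_nat n.
Proof.
move=> n0; rewrite /collatz_nat; case: ifPn => on; rewrite divn_gt0 //.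
  by rewrite addn1 ltnS muln_gt0.
by case: n n0 on => [|[|]].
Qed.

Definition collatz (n : posN) : posN :=
  PosN (collatz_nat_gt0 (posN_gt0 n)).

Section Dynamics.
Local Open Scope ring_scope.
Local Open Scope ereal_scope.
Context {R : realType}.
Implicit Types (nu : {measure set posN -> \bar R}) (S : posN -> posN).

Definition equivalent_to_counting nu : Prop := forall n : posN, 0 < nu [set n].

Definition power_bounded nu S : Prop :=
  exists M : R, forall (n : nat) (A : set posN), (0 < n)%N ->
    nu (iter n S @^-1` A) <= M%:E * nu A.

(* As in power_bounded, the exponents range over the natural numbers from 1; for
   surjective S (such as collatz), allowing 0 gives the same notion. *)
Definition wandering S (W : set posN) : Prop :=
  forall i j : nat, (0 < i)%N -> (0 < j)%N -> i <> j ->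
    iter i S @^-1` W `&` iter j S @^-1` W = set0.

Definition conservative_on nu S (C : set posN) : Prop :=
  forall A : set posN, A `<=` C -> 0 < nu A ->
    {ae nu, forall x, A x -> forall m : nat, exists2 k : nat,
      (m <= k)%N & A (iter k S x)}.

(* C is the conservative part of the Hopf decomposition; it is unique up to a
   nu-null set, hence unique when every singleton has positive measure. *)
Definition conservative_part nu S (C : set posN) : Prop :=
  [/\ C `<=` S @^-1` C,
      conservative_on nu S C &
      exists W : nat -> set posN,
        (forall i, wandering S (W i)) /\ ~` C = \bigcup_i W i].

End Dynamics.

(* Main.v *)
Require Import Defs.
From HB Require Import structures.
From mathcomp Require Import all_boot all_order all_algebra.
From mathcomp Require Import all_classical all_reals all_analysis.
From mathcomp Require Import zify.

Import Order.TTheory GRing.Theory Num.Theory.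
Import numFieldNormedType.Exports.
Local Open Scope classical_set_scope.
Local Open Scope ring_scope.

Set Implicit Arguments.
Unset Strict Implicit.

(** Write T for the Collatz map and C for {1, 2}, which T maps into itself.

    From a measure to absorption.  The point T^k n pulls back to n, so power
    boundedness gives alpha {n} <= M alpha {T^k n}: the tails of every orbit
    keep a mass bounded below.  In a finite measure these decreasing tails
    cannot shrink to the empty set, so some point is visited infinitely often,
    and the orbit of n reaches a periodic point
    ([power_bounded_recurrent]).  A wandering set contains no periodic point
    ([wandering_aperiodic]), so this point lies in the conservative part C.

    From absorption to a measure.  Every point has at most two preimages, so
    T^-k C has at most 2^k #C points, and
      alpha A = \sum_k 4^-k #(A `&` T^-k C)
    is finite; it charges every point because the sets T^-k C cover.  If A
    misses the invariant set C, then T^-n A misses T^-j C for j < n, and for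
    j = n + i the weight 4^-n beats the at most 2^n-fold growth of
    A `&` T^-i C under T^-n, so that alpha (T^-n A) <= alpha A.  If A meets C,
    then alpha A >= 1, and the total mass serves as the constant
    ([basin_measure_power_bounded]).  The complement of C is the union of the
    sets of points that enter C at a given time, which are wandering
    ([absorbed_bigcup_wandering]), and C is a 2-cycle, hence conservative. *)

(** * Finite power bounded measures force periodic points *)

(** A point of period p would lie in both the p-th and the 2p-th preimage. *)
Lemma wandering_aperiodic (S : posN -> posN) (W : set posN) (x : posN)
  (p : nat) : wandering S W -> W x -> (0 < p)%N -> iter p S x <> x.
Proof.
move=> wW Wx p0 px.
have px2 : iter (p + p) S x = x by rewrite iterD !px.
have : (iter p S @^-1` W `&` iter (p + p) S @^-1` W) x.
  by split; rewrite /= ?px ?px2.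
by rewrite wW //; lia.
Qed.

(** A reverse Borel-Cantelli argument: the limsup of the singletons of the
    orbit has mass at least alpha {n} / M, so it contains a point, and this
    point is visited at two different times. *)
Lemma power_bounded_recurrent (R : realType)
    (alpha : {finite_measure set posN -> \bar R}) (S : posN -> posN)
    (n : posN) :
  power_bounded alpha S -> (0 < alpha [set n])%E ->
  exists i p, (0 < p)%N /\ iter p S (iter i S n) = iter i S n.
Proof.
move=> [M bM] n0.
(* The shift by one keeps to the positive exponents of power_bounded. *)
pose F k := [set iter k.+1 S n].
have mF k : measurable (F k) by [].
have Uoo : (alpha (\bigcup_(k >= 0) F k) < +oo)%E.
  by rewrite ltey_eq fin_num_measure.
have cvU := cvgeZl (isT : M%:E \is a fin_num) (lim_sup_set_cvg alpha F mF Uoo).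
have nU K : (alpha [set n] <= M%:E * alpha (\bigcup_(k >= K) F k))%E.
  apply: le_trans (bM K.+1 _ isT); apply: le_measure; rewrite ?inE//.
  by move=> _ ->; exists K => //=.
have : (alpha [set n] <= M%:E * alpha (lim_sup_set F))%E.
  rewrite -(cvg_lim _ cvU)//; apply: lime_ge.
    by apply/cvg_ex; eexists; exact: cvU.
  exact: nearW.
have [->|/set0P[x Fx]] := eqVneq (lim_sup_set F) set0.
  by rewrite measure0 mule0 leNgt n0.
move=> _; have [i _ xi] := Fx 0 I; have [j /= ij xj] := Fx i.+1 I.
exists i.+1, (j - i)%N; split; first by rewrite subn_gt0.
rewrite -iterD (_ : (j - i + i.+1)%N = j.+1); last by lia.
by rewrite -[LHS]xj -[RHS]xi.
Qed.

(** * A power bounded measure for an absorbing set *)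

Lemma absorbing_iter (S : posN -> posN) (C : set posN) (i j : nat) :
  C `<=` S @^-1` C -> (i <= j)%N -> iter i S @^-1` C `<=` iter j S @^-1` C.
Proof.
move=> SC /subnK <-; elim: (j - i)%N => [//|m IH] x /IH; exact: SC.
Qed.

Section AbsorbingMeasure.
Local Open Scope ereal_scope.
Context (R : realType) (S : posN -> posN) (C : set posN) (d : R).
Context (d0 : (0 < d)%R) (finC : finite_set C) (SC : C `<=` S @^-1` C)
  (fibS : forall B, counting (S @^-1` B) <= d%:E * counting B)
  (absC : forall n, exists k, C (iter k S n)).

Let basin k : set posN := iter k S @^-1` C.
(* The factor d^-1 offsets the growth of preimages, 2^-1 gives convergence. *)
Let q : R := (2 * d)^-1%R.
Let q_gt0 : (0 < q)%R. Proof. by rewrite invr_gt0 mulr_gt0. Qed.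
Let qX_ge0 k : (0 <= q ^+ k)%R. Proof. by rewrite exprn_ge0// ltW. Qed.
Let mbasin k : measurable (basin k). Proof. by []. Qed.

(** The point x gets the sum of q^k over the k with S^k x in C, a constant
    multiple of q^t for t the entrance time of x in C.  Summing over all
    such k, rather than taking q^t, gives a series over the sets S^-k C, and
    the preimage under S^n of such a set is again one of them. *)
Definition basin_measure : set posN -> \bar R :=
  mseries (fun k => mscale (NngNum (qX_ge0 k)) (mrestr counting (mbasin k))) 0.

HB.instance Definition _ := Measure.on basin_measure.

Lemma basin_measureE A :
  basin_measure A = \sum_(k <oo) (q ^+ k)%:E * counting (A `&` basin k).
Proof. by []. Qed.

Lemma counting_preimage_iter k B :
  counting (iter k S @^-1` B) <= (d ^+ k)%:E * counting B.
Proof.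
elim: k B => [|k IH] B; first by rewrite expr0 mul1e.
apply: le_trans (IH (S @^-1` B)) _.
rewrite exprSr EFinM -muleA lee_wpmul2l ?lee_fin//.
by rewrite exprn_ge0// ltW.
Qed.

Lemma basin_measure_point k x : basin k x ->
  (q ^+ k)%:E <= basin_measure [set x].
Proof.
move=> kx; rewrite basin_measureE.
rewrite (@nneseriesD1 _ _ k xpredT)//; last by move=> i _; rewrite mule_ge0// lee_fin.
rewrite (_ : [set x] `&` basin k = [set x]); last first.
  by apply/setIidl => _ ->.
have -> : counting [set x] = 1 :> \bar R.
  by rewrite /counting asboolT ?finite_set1// fset_set1 finmap.cardfs1.
by rewrite mule1 leeDl// nneseries_ge0// => i _ _; rewrite mule_ge0// lee_fin.
Qed.

Let qXdX k : (q ^+ k * d ^+ k = 2^-1 ^+ k :> R)%R.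
Proof. by rewrite -exprMn /q invfM mulfVK// gt_eqF. Qed.

Lemma basin_measureT : basin_measure setT < +oo.
Proof.
rewrite basin_measureE.
have hC : (counting C : \bar R) \is a fin_num by rewrite /counting asboolT.
apply: (@le_lt_trans _ _ (\sum_(k <oo) (fine (counting C) * 2^-1 ^+ k)%:E)).
  apply: lee_nneseries => [i _ _|k _]; first by rewrite mule_ge0// lee_fin.
  rewrite setTI mulrC -qXdX -mulrA !EFinM lee_wpmul2l ?lee_fin// fineK//.
  exact: counting_preimage_iter.
have := @is_cvg_geometric_series R (fine (counting C)) (2^-1).
rewrite ger0_norm ?invr_ge0// invf_lt1 ?ltr1n// => /(_ isT) /= cv.
rewrite [X in X < _](_ : _ = (limn (series (geometric (fine (counting C)) (2^-1 : R))))%:E) ?ltry//.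
rewrite -EFin_lim//; congr (limn _); apply/funext => n /=.
by rewrite sumEFin.
Qed.

Lemma basin_measure_fin : fin_num_fun basin_measure.
Proof.
move=> A mA; rewrite ge0_fin_numE//; apply: le_lt_trans basin_measureT.
by apply: le_measure; rewrite ?inE.
Qed.

HB.instance Definition _ :=
  Measure_isFinite.Build _ _ _ basin_measure basin_measure_fin.

(** Preimages of a set outside C are not heavier than the set: in the series
    for the preimage under the n-th iterate the first n terms vanish, and the
    term of index i + n is at most 2^-n times the term of index i of the
    series for A. *)
Lemma basin_measure_preimage_disjoint n A : A `&` C = set0 ->
  basin_measure (iter n S @^-1` A) <= basin_measure A.
Proof.
move=> AC0; rewrite !basin_measureE.
rewrite (@nneseries_split _ _ 0%N n); last by move=> k _; rewrite mule_ge0// lee_fin.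
rewrite big1_seq ?add0e => [|j].
  rewrite add0n -nneseries_addn => [|k]; last by rewrite mule_ge0// lee_fin.
  apply: lee_nneseries => [k _ _|k _]; first by rewrite mule_ge0// lee_fin.
  rewrite (_ : _ `&` _ = iter n S @^-1` (A `&` basin k)); last first.
    by apply/seteqP; split=> x; rewrite /basin /= iterD.
  rewrite exprD EFinM -muleA lee_wpmul2l ?lee_fin//.
  apply: (@le_trans _ _
      ((q ^+ n)%:E * ((d ^+ n)%:E * counting (A `&` basin k)))).
    by rewrite lee_wpmul2l ?lee_fin// counting_preimage_iter.
  rewrite muleA -EFinM qXdX -[leRHS]mul1e lee_wpmul2r// lee_fin.
  by rewrite exprn_ile1// ?invr_ge0// invf_le1// ler1n.
rewrite mem_index_iota add0n => /andP[_ /andP[_ jn]].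
rewrite (_ : _ `&` _ = set0) ?measure0 ?mule0//.
rewrite -subset0 => x [/= Ax Cx].
suff : (A `&` C) (iter n S x) by rewrite AC0.
by split=> //; exact: (absorbing_iter SC (ltnW jn)) Cx.
Qed.

(** A set that meets C has mass at least 1, so there the total mass is a
    bound. *)
Lemma basin_measure_power_bounded : power_bounded basin_measure S.
Proof.
exists (Num.max 1 (fine (basin_measure setT)))%R => n A _.
have [AC0|/set0P[x [Ax Cx]]] := eqVneq (A `&` C) set0.
  apply: (le_trans (basin_measure_preimage_disjoint n AC0)).
  by rewrite -[leLHS]mul1e lee_wpmul2r// lee_fin le_max lexx.
have A1 : 1 <= basin_measure A.
  apply: (@le_trans _ _ (basin_measure [set x])).
    by have := @basin_measure_point 0 x Cx; rewrite expr0.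
  by apply: le_measure; rewrite ?inE// => _ ->.
apply: (@le_trans _ _ (basin_measure setT)).
  by apply: le_measure; rewrite ?inE.
rewrite -[leLHS]mule1 -[in leLHS](fineK (fin_num_measure basin_measure setT _))//.
rewrite lee_pmul// ?lee_fin ?fine_ge0//.
by rewrite le_max lexx orbT.
Qed.

Lemma basin_measure_equivalent : equivalent_to_counting basin_measure.
Proof.
move=> n; have [k Ck] := absC n; apply: lt_le_trans (basin_measure_point Ck).
by rewrite lte_fin exprn_gt0.
Qed.

Lemma absorbing_finite_measure :
  exists alpha : {finite_measure set posN -> \bar R},
    equivalent_to_counting alpha /\ power_bounded alpha S.
Proof.
exists basin_measure; split.
  exact: basin_measure_equivalent.
exact: basin_measure_power_bounded.
Qed.

End AbsorbingMeasure.

(** * The dissipative part of an absorbed system *)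

(** The wandering sets are the level sets of the entrance time in C, since the
    i-th preimage of a level set is the level set i units later. *)
Lemma absorbed_bigcup_wandering (S : posN -> posN) (C : set posN) :
    C `<=` S @^-1` C -> (forall n, exists k, C (iter k S n)) ->
  exists W : nat -> set posN,
    (forall i, wandering S (W i)) /\ ~` C = \bigcup_i W i.
Proof.
move=> SC absC.
have mono m i j : (i <= j)%N -> C (iter i S m) -> C (iter j S m).
  by move=> ij Ci; exact: (absorbing_iter SC ij) Ci.
exists (fun k => [set m | C (iter k.+1 S m) /\ ~ C (iter k S m)]); split.
  move=> k i j _ _ ij; rewrite -subset0 => m /=; rewrite -!iterD.
  wlog lt_ij : i j ij / (i < j)%N.
    move=> H [a b]; have [|ji] : (i < j)%N \/ (j < i)%N by lia.
      by move=> /H; apply.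
    by apply: (H j i) => //; [exact/nesym].
  by move=> [[Ci _] [_ Cj]]; apply: Cj; apply: (mono m (k + i).+1) Ci; lia.
apply/seteqP; split=> [m Cm|m [k _ [_ Ck]] Cm]; last first.
  exact/Ck/(mono m 0%N k).
have [k Ck] := absC m; elim: k Ck => [//|k IH] Ck.
by have [/IH//|nCk] := pselect (C (iter k S m)); exists k.
Qed.

(** * The Collatz map *)

Lemma counting_preimage_inj {R : realType} (T : choiceType) (U : pointedType)
    (f : T -> U) (E : set T) (B : set U) :
  {in E &, injective f} -> (counting (E `&` f @^-1` B) <= counting B :> \bar R)%E.
Proof.
move=> injf.
have leEB : (E `&` f @^-1` B #<= B)%card.
  apply/pcard_leP/injfunPex; exists f; first by move=> x [].
  by move=> x y /set_mem[Ex _] /set_mem[Ey _]; apply: injf; exact/mem_set.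
rewrite /counting; case: (asboolP (finite_set B)) => [finB|_]; last first.
  by rewrite leey.
have finE := card_le_finite leEB finB; rewrite asboolT// lee_fin ler_nat.
have /finite_setP[m Bm] := finB; rewrite (card_fset_set Bm).
by apply: geq_card_fset_set; rewrite -(card_le_eqr Bm).
Qed.

Lemma collatz_even_inj : {in [set n : posN | ~~ odd n] &, injective collatz}.
Proof.
move=> x y /set_mem /= ex /set_mem /= ey /(congr1 posN_val) /=.
by rewrite /collatz_nat (negbTE ex) (negbTE ey) => exy; apply: val_inj => /=; lia.
Qed.

Lemma collatz_odd_inj : {in ~` [set n : posN | ~~ odd n] &, injective collatz}.
Proof.
move=> x y /set_mem /= /negP/negPn ex /set_mem /= /negP/negPn ey.
move=> /(congr1 posN_val) /=.
by rewrite /collatz_nat ex ey => exy; apply: val_inj => /=; lia.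
Qed.

(** The collatz map is injective on the even and on the odd numbers, so each
    point has at most one preimage of either parity. *)
Lemma counting_preimage_collatz {R : realType} (B : set posN) :
  (counting (collatz @^-1` B) <= 2%:E * counting B :> \bar R)%E.
Proof.
rewrite -[collatz @^-1` B]setTI -(setUv [set n : posN | ~~ odd n]) setIUl.
apply: (@le_trans _ _ _ _ _ (measureU2 (@counting posN R) _ _)) => //.
rewrite (_ : 2%:E = 1 + 1)%E// ge0_muleDl// mul1e.
by apply: leeD; apply: counting_preimage_inj;
  [exact: collatz_even_inj|exact: collatz_odd_inj].
Qed.

Lemma collatz12 x : [set posN1; posN2] x -> [set posN1; posN2] (collatz x).
Proof. by case=> ->; [right|left]; exact: val_inj. Qed.

Lemma collatz12_period2 x : [set posN1; posN2] x ->
  collatz (collatz x) = x.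
Proof. by case=> ->; exact: val_inj. Qed.

Lemma collatz12_conservative (R : realType)
    (nu : {measure set posN -> \bar R}) :
  conservative_on nu collatz [set posN1; posN2].
Proof.
move=> A AC _; apply: aeW => x Ax m; exists (m * 2)%N; first by lia.
suff -> : iter (m * 2) collatz x = x by [].
rewrite iterM iter_fix//; exact: collatz12_period2 (AC _ Ax).
Qed.

Unset Implicit Arguments.
Set Strict Implicit.

Theorem theorem1p2 (R : realType) :
  (exists alpha : {finite_measure set posN -> \bar R},
     [/\ equivalent_to_counting alpha,
         power_bounded alpha collatz &
         conservative_part alpha collatz [set posN1; posN2]])
  <->
  (forall n : posN, exists k : nat, [set posN1; posN2] (iter k collatz n)).
Proof.
split=> [[alpha [eq_a pb_a [_ _ [W [wW CW]]]]] n|absC].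
  have [i [p [p0 per]]] := power_bounded_recurrent pb_a (eq_a n).
  exists i; apply: contrapT => nC.
  have [k _ Wk] : (\bigcup_i W i) (iter i collatz n) by rewrite -CW.
  exact: wandering_aperiodic (wW k) Wk p0 per.
have fin12 : finite_set [set posN1; posN2] by exact: finite_set2.
have [alpha [eq_a pb_a]] := @absorbing_finite_measure R collatz _ 2
  (ltr0Sn _ 1) fin12 collatz12 (@counting_preimage_collatz R) absC.
exists alpha; split=> //; split.
- exact: collatz12.
- exact: collatz12_conservative.
- exact: absorbed_bigcup_wandering collatz12 absC.
Qed.
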